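(* Let $H$ be a separable real Hilbert space with inner product $\langle\cdot,\cdot\rangle$, let $(\Omega,\mathscr{F},\mathbb{P})$ be a complete probability space, and let $\xi:\Omega\to H$ be a centered random element in $H$ of strong second order, with covariance operator $R$. Then $\xi \perp \ker(R)$ almost surely; that is, for $\mathbb{P}$-almost every $\omega\in\Omega$ one has $\langle \xi(\omega),h\rangle=0$ for every $h\in\ker(R)$.
   Context: A random element in a separable Hilbert space $H$ is a Borel measurable map $\xi:\Omega\to H$. It is of strong second order, written $\xi\in L^2_{\mathbb{P}}(H)$, if $\mathbb{E}\|\xi\|^2<\infty$. Its expectation $\mathbb{E}\xi$ is the unique element of $H$ with $\mathbb{E}\langle\xi,f\rangle=\langle\mathbb{E}\xi,f\rangle$ for all $f\in H$, and $\xi$ is centered if $\mathbb{E}\xi=0$. The covariance operator of $\xi\in L^2_{\mathbb{P}}(H)$ is the (nuclear) operator $R:H\to H$, $R(h):=\mathbb{E}\big[\langle\xi,h\rangle\xi\big]$, $h\in H$, i.e. $\langle R(h),f\rangle=\mathbb{E}\langle\xi,h\rangle\langle\xi,f\rangle$ for all $h,f\in H$. *)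

(* Defs.v *)
(* MathComp-Analysis *)
From HB Require Import structures.
From mathcomp Require Import all_boot all_order all_algebra.
From mathcomp Require Import all_classical all_reals all_analysis.
Set Implicit Arguments.
Unset Strict Implicit.
Unset Printing Implicit Defensive.
Import Order.TTheory GRing.Theory Num.Theory.
Import numFieldNormedType.Exports.
Local Open Scope classical_set_scope.
Local Open Scope ring_scope.

(* A real Hilbert space is a complete normed module over [R : realType] with a
   positive definite symmetric bilinear form (the conjugation of [{dot _ for _}]
   being trivial) that induces its norm. *)
Definition induces_norm (R : realType) (H : normedModType R)
    (ip : {dot H for idfun}) : Prop :=
  forall x : H, ip x x = `|x| ^+ 2.

Definition separable (T : topologicalType) : Prop :=
  exists2 D : set T, countable D & dense D.

Definition borel_measurable d (T : measurableType d) (R : realType)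
    (H : normedModType R) (X : T -> H) : Prop :=
  measurable_fun [set: T] (X : T -> g_sigma_algebraType (@open H)).

Definition strong_second_order d (T : measurableType d) (R : realType)
    (P : probability T R) (H : normedModType R) (X : T -> H) : Prop :=
  ('E_P[fun w => (`|X w| ^+ 2)%R] < +oo)%E.

(* ['E_P[_]] takes values in [\bar R] and the right-hand side is finite, so
   the scalar expectations are finite as well. *)
Definition is_expectation d (T : measurableType d) (R : realType)
    (P : probability T R) (H : normedModType R) (ip : {dot H for idfun})
    (X : T -> H) (m : H) : Prop :=
  forall f : H, 'E_P[fun w => ip (X w) f]%E = (ip m f)%:E.

Lemma is_expectation_unique d (T : measurableType d) (R : realType)
    (P : probability T R) (H : normedModType R) (ip : {dot H for idfun})
    (X : T -> H) (m m' : H) :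
  is_expectation P ip X m -> is_expectation P ip X m' -> m = m'.
Proof.
move=> Xm Xm'; apply/eqP; rewrite -subr_eq0; apply: contraT.
move=> /(@neq0_dnorm_gt0 _ _ _ ip); rewrite linearBl.
by have /= := Xm (m - m'); rewrite Xm' => -[->]; rewrite subrr ltxx.
Qed.

Definition centered d (T : measurableType d) (R : realType)
    (P : probability T R) (H : normedModType R) (ip : {dot H for idfun})
    (X : T -> H) : Prop :=
  is_expectation P ip X 0.

Definition is_covariance_operator d (T : measurableType d) (R : realType)
    (P : probability T R) (H : normedModType R) (ip : {dot H for idfun})
    (X : T -> H) (C : H -> H) : Prop :=
  forall h : H, is_expectation P ip (fun w => ip (X w) h *: X w) (C h).

(* Main.v *)
Require Import Defs.
From HB Require Import structures.
From mathcomp Require Import all_boot all_order all_algebra.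
From mathcomp Require Import all_classical all_reals all_analysis.
From mathcomp Require Import measurable_realfun ring.
Import Order.TTheory GRing.Theory Num.Theory.
Import numFieldNormedType.Exports.
Local Open Scope classical_set_scope.
Local Open Scope ring_scope.

(** For a single [h] in the kernel of the covariance operator [C],
    [E <xi, h>^2 = <C h, h> = 0], so [<xi, h>] vanishes almost surely
    ([ae_dot_eq0]).  The exceptional event depends on [h], and the kernel is in
    general uncountable; but every subset of a separable metric space has a
    countable subset that is dense in it ([countable_dense_subset]), so a single
    null event serves for a countable dense part [S] of the kernel
    ([ae_forall_countable]).  Outside that event the set of the [h] that are
    orthogonal to [xi w] is closed, since [<xi w, ->] is continuous, and contains
    [S]; hence it contains the whole kernel. *)

(** Separability passes to arbitrary subsets in the metric case: for each point
    [q] of a countable dense set and each radius [1 / n.+1], pick a point of [K]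
    in [ball q n.+1^-1] whenever there is one. *)
Lemma countable_dense_subset (R : realType) (T : pseudoMetricType R)
    (K : set T) :
  separable T -> 
    exists S : set T, [/\ countable S, S `<=` K & K `<=` closure S].
Proof.
move=> [D cD dD].
(* Picking a set with at most one element, rather than a point, avoids a
   default value for the balls that miss [K]. *)
have pickP (A : set T) : exists s : set T,
    [/\ countable s, s `<=` A & A !=set0 -> s !=set0].
  have [[a Aa]|A0] := pselect (A !=set0).
    exists [set a]; split; [|by move=> _ ->|by exists a].
    exact/finite_set_countable/finite_set1.
  by exists set0; split=> // /A0.
have [pick pick_spec] := choice pickP.
pose near_pt q n := pick (K `&` ball q (n.+1%:R^-1 : R)).
exists (\bigcup_(q in D) \bigcup_n near_pt q n); split.
- apply: bigcup_countable => // q _; apply: bigcup_countable => // n _.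
  by have [] := pick_spec (K `&` ball q (n.+1%:R^-1 : R)).
- move=> x [q _ [n _ pqx]].
  by have [_ /(_ _ pqx)[]] := pick_spec (K `&` ball q (n.+1%:R^-1 : R)).
move=> x Kx B /nbhs_ballP[_/posnumP[e] eB].
(* The radius is below [e / 2], so that two balls around [q] fit in one of
   radius [e]. *)
have [//|N] := @ltr_add_invr R 0%R (e%:num / 2) _; rewrite add0r => /ltW Ne.
have N0 : (0 : R) < N.+1%:R^-1 by rewrite invr_gt0.
have [|q [/interior_subset xq Dq]] := dD (ball x N.+1%:R^-1)° _ (open_interior _).
  by exists x; exact: nbhsx_ballx.
have [_ sub /(_ _)] := pick_spec (K `&` ball q (N.+1%:R^-1 : R)).
case=> [|y pqy]; first by exists x; split=> //; exact: ball_sym.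
exists y; split; first by exists q => //; exists N.
apply: eB; rewrite [e%:num]splitr; apply: (@ball_triangle _ _ q).
  exact: (le_ball Ne).
by apply: (le_ball Ne); have [] := sub _ pqy.
Qed.

Lemma ae_forall_countable (d : measure_display) (T : measurableType d)
    (R : realType) (mu : {measure set T -> \bar R}) (I : Type) (S : set I)
    (Q : I -> T -> Prop) :
  countable S -> (forall i, S i -> {ae mu, forall x, Q i x}) ->
  {ae mu, forall x, forall i, S i -> Q i x}.
Proof.
move=> /countable_injP[f finj] aeQ.
have : {ae mu, forall x, forall n i, S i -> f i = n -> Q i x}.
  apply: ae_foralln => n.
  (* At most one index of [S] has code [n]; none makes the claim vacuous. *)
  have [[i [Si <-]]|noi] := pselect (exists i, S i /\ f i = n).
    apply: filterS (aeQ i Si) => x Qix j Sj fji.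
    by rewrite (finj j i) ?inE.
  by apply: nearW => x i Si fin; case: noi; exists i.
by apply: filterS => x Qx i Si; exact: (Qx (f i) i Si erefl).
Qed.

(** The form is defined algebraically; expressing it by the norm is what links it
    to the topology. *)
Lemma dot_polarization (R : realType) (H : normedModType R)
    (ip : {dot H for idfun}) (x y : H) :
  induces_norm ip -> ip x y = 4%:R^-1 * (`|x + y| ^+ 2 - `|x - y| ^+ 2).
Proof.
move=> hip; rewrite -!hip.
(* Restated for [ip] as a dot product: the generic lemmas yield it as a bilinear
   map, a different head that blocks the rewriting by symmetry. *)
have ipC a b : ip a b = ip b a by rewrite hermC expr0 mul1r.
have ipDl a b c : ip (a + b) c = ip a c + ip b c by exact: linearDl.
have ipNl a c : ip (- a) c = - ip a c by exact: linearNl.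
rewrite !ipDl ![ip _ (_ + _)]ipC !ipDl !ipNl.
rewrite [ip x (- y)]ipC [ip y (- y)]ipC !ipNl (ipC y x).
by field.
Qed.

Lemma continuous_dotr (R : realType) (H : normedModType R)
    (ip : {dot H for idfun}) (y : H) :
  induces_norm ip -> continuous (fun x => ip x y).
Proof.
move=> hip; rewrite (_ : (fun x => ip x y) =
  fun x => 4%:R^-1 * (`|x + y| ^+ 2 - `|x - y| ^+ 2)); last first.
  by apply/funext => x; exact: dot_polarization.
move=> x; apply: cvgM; first exact: cvg_cst.
apply: cvgB; apply: (@cvgM _ _ _ _ (fun=> _) (fun=> _));
  apply: cvg_norm; (apply: cvgD || apply: cvgB); by [exact: cvg_id|exact: cvg_cst].
Qed.

Lemma continuous_dotl (R : realType) (H : normedModType R)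
    (ip : {dot H for idfun}) (x : H) :
  induces_norm ip -> continuous (ip x).
Proof.
move=> hip; rewrite (_ : ip x = (fun y => ip y x) :> (H -> R)).
  exact: continuous_dotr.
by apply/funext => y; rewrite hermC expr0 mul1r.
Qed.

Lemma borel_measurable_comp_continuous (d : measure_display)
    (T : measurableType d) (R : realType) (H : normedModType R) (X : T -> H)
    (g : H -> R) :
  borel_measurable X -> continuous g -> measurable_fun [set: T] (g \o X).
Proof.
move=> mX /continuousP cg.
apply: (measurability _ (RGenOpens.measurableE R)).
move=> _ [_ [a [b ->]] <-]; rewrite comp_preimage; apply: (mX measurableT).
by apply: sub_sigma_algebra; exact/cg/interval_open.
Qed.

(** [<X, h>^2] is nonnegative with expectation [<C h, h> = 0], and a nonnegative
    function of zero integral vanishes almost everywhere. *)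
Lemma ae_dot_eq0 (d : measure_display) (T : measurableType d) (R : realType)
    (P : probability T R) (H : normedModType R) (ip : {dot H for idfun})
    (X : T -> H) (C : H -> H) (h : H) :
  induces_norm ip -> borel_measurable X -> is_covariance_operator P ip X C ->
  C h = 0 -> {ae P, forall w, ip (X w) h = 0}.
Proof.
move=> hip mX hC Ch0.
pose Xh : T -> R := fun w => ip (X w) h.
have mXh : measurable_fun [set: T] Xh.
  apply: (borel_measurable_comp_continuous _ _ _ _ _ (fun x => ip x h) mX).
  exact: continuous_dotr.
have sq0 : (\int[P]_w `|(Xh w ^+ 2)%:E| = 0)%E.
  have <- : (ip (C h) h)%:E = 0%E by rewrite Ch0; congr EFin; exact: linear0l.
  rewrite -hC unlock; apply: eq_integral => w _.
  have -> : ip (ip (X w) h *: X w) h = Xh w * Xh w by exact: linearZl_LR.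
  by rewrite gee0_abs ?lee_fin ?sqr_ge0// expr2.
have mXh2 : measurable_fun [set: T] (fun w => (Xh w ^+ 2)%:E).
  exact/measurable_EFinP/measurable_funX.
have [/(_ sq0) + _] := ae_eq_integral_abs P measurableT mXh2.
by apply: filterS => w /(_ I)[] /eqP; rewrite sqrf_eq0 => /eqP.
Qed.

Theorem theorem1 (R : realType) (H : completeNormedModType R)
    (ip : {dot H for idfun}) (hip : induces_norm ip) (hsep : separable H)
    (d : measure_display) (Omega : measurableType d) (P : probability Omega R)
    (hP : measure_is_complete P)
    (xi : Omega -> H) (xi_borel : borel_measurable xi)
    (xi_L2 : strong_second_order P xi) (xi_centered : centered P ip xi)
    (C : H -> H) (hC : is_covariance_operator P ip xi C) :
  {ae P, forall w, forall h : H, C h = 0 -> ip (xi w) h = 0}.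
Proof.
have [S [cS SK KS]] := @countable_dense_subset R H [set h | C h = 0] hsep.
have /(ae_forall_countable _ _ _ _ _ _ _ cS) : forall h, S h ->
    {ae P, forall w, ip (xi w) h = 0}.
  by move=> h /SK; exact: ae_dot_eq0.
apply: filterS => w Sw h /KS clSh.
have /closure_id orth_closed : closed [set h | ip (xi w) h = 0].
  apply: (@closed_comp _ _ (ip (xi w)) [set x | x = 0]); last exact: closed_eq.
  by move=> g _; exact: continuous_dotl.
suff : [set h | ip (xi w) h = 0] h by [].
by rewrite orth_closed; apply: closure_subset clSh => g; exact: Sw.
Qed.
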